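(* Let $F_c$ be a finite union-closed family of finite sets. Suppose there exist finite families $F_0,\ldots,F_k$ and natural numbers $c_0,\ldots,c_k$ such that (1) for every $0\le i\le k$, $F_i\in \mathrm{uce}(F_c)$; (2) for every $a\in\bigcup F_c$, $\sum_{i=0}^k c_i\cdot\bigl(2\cdot \mathrm{cnt}(a,F_i)-|F_i|\bigr)<0$ (computed in the integers); (3) $c_i>0$ for some $0\le i\le k$. Then $F_c$ is not an FC-family.
   Context: All sets and families are finite. A family $F$ is union-closed if $A\cup B\in F$ for all $A,B\in F$. A family $F$ is union-closed for $F_c$ if $F$ is union-closed and $A\cup B\in F$ for all $A\in F$, $B\in F_c$. The collection of union-closed extensions of $F_c$ is $\mathrm{uce}(F_c)=\{F : F\subseteq \mathcal{P}(\bigcup F_c) \text{ and } F \text{ is union-closed for } F_c\}$, where $\mathcal{P}$ denotes the power set. For an element $a$ and family $F$, $\mathrm{cnt}(a,F)=|\{A\in F: a\in A\}|$. A family $F_c$ is an FC-family if for every (finite) union-closed family $F\supseteq F_c$ there is an element $a\in\bigcup F_c$ with $2\cdot\mathrm{cnt}(a,F)\ge |F|$; otherwise it is a nonFC-family. *)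

(* Defs.v *)
(* MathComp with finmap: finite sets {fset K} over an arbitrary choiceType. *)
From HB Require Import structures.
From mathcomp Require Import all_boot all_order all_algebra finmap.

Set Implicit Arguments.
Unset Strict Implicit.
Unset Printing Implicit Defensive.

Local Open Scope fset_scope.

(* The elements of all sets are drawn from one universe K.  The quantification
   over all finite families in FC_family has its intended meaning only when
   fresh elements are always available, that is, when K is infinite. *)
Definition infinite_universe (K : choiceType) : Prop :=
  forall s : {fset K}, exists x : K, x \notin s.

Definition union_closed (K : choiceType) (F : {fset {fset K}}) : Prop :=
  forall A B : {fset K}, A \in F -> B \in F -> A `|` B \in F.

Definition union_closed_for (K : choiceType) (Fc F : {fset {fset K}}) : Prop :=
  union_closed F /\
  forall A B : {fset K}, A \in F -> B \in Fc -> A `|` B \in F.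

(* fcover Fc is the union of all members of Fc. *)
Definition uce (K : choiceType) (Fc F : {fset {fset K}}) : Prop :=
  F `<=` fpowerset (fcover Fc) /\ union_closed_for Fc F.

Definition cnt (K : choiceType) (a : K) (F : {fset {fset K}}) : nat :=
  #|` [fset A in F | a \in A] |.

Definition FC_family (K : choiceType) (Fc : {fset {fset K}}) : Prop :=
  forall F : {fset {fset K}}, union_closed F -> Fc `<=` F ->
  exists2 a : K, a \in fcover Fc & (#|` F| <= 2 * cnt a F)%N.

(* Main.v *)
(* Write U for the union of Fc and surplus a F := 2 cnt(a, F) - |F|.  Put
   m := |Fc| + 1 and take m * c_i copies of each F_i, indexed by j.  Choose
   fresh distinct elements x_j, and one more, and let X be the set of them all.
   The family consisting of Fc, of the A `|` (X `\ x_j) for A in the j-th copy,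
   and of the A `|` X for all A `<=` U is union-closed: two different tops
   X `\ x_j have union X, and joining with members of Fc stays in each F_i.
   These blocks are disjoint, so surpluses add up: the powerset block
   contributes 0, the copies at most -m, and Fc at most |Fc| < m.  Hence every
   a in U has negative surplus. *)
Require Import Defs.
From mathcomp Require Import all_boot all_order all_algebra finmap.
From mathcomp Require Import zify.

Set Implicit Arguments.
Unset Strict Implicit.
Unset Printing Implicit Defensive.

Import Order.TTheory GRing.Theory Num.Theory.
Local Open Scope ring_scope.
Local Open Scope fset_scope.

Lemma fresh_family (K : choiceType) (K_inf : infinite_universe K)
    (U : {fset K}) (J : finType) :
  exists x : J -> K, injective x /\ (forall j, x j \notin U).
Proof.
have [s [sz_s uniq_s sU]] : exists s : seq K,
    [/\ size s = #|J|, uniq s & forall y, y \in s -> y \notin U].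
  elim: #|J| => [|n [s [sz_s uniq_s sU]]]; first by exists [::].
  have [y] := K_inf (U `|` seq_fset tt s).
  rewrite in_fsetU seq_fsetE negb_or => /andP[yU ys].
  exists (y :: s); split=> /=; rewrite ?sz_s ?ys // => z.
  by rewrite inE => /predU1P[-> // | /sU].
(* [x0] only serves as the default of [nth]: every rank is below [size s]. *)
have [x0 _] := K_inf fset0.
have lt_s (j : J) : (enum_rank j < size s)%N by rewrite sz_s.
exists (fun j => nth x0 s (enum_rank j)); split=> [i j /eqP|j].
  by rewrite nth_uniq // => /eqP/val_inj/enum_rank_inj.
exact/sU/mem_nth.
Qed.

Definition surplus (K : choiceType) (a : K) (F : {fset {fset K}}) : int :=
  2 * (cnt a F)%:Z - (#|` F|)%:Z.

(** Each member weighs 1 or -1, which makes the surplus additive over disjoint families. *)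
Lemma surplusE (K : choiceType) (a : K) (F : {fset {fset K}}) :
  surplus a F = \sum_(A <- F) (2 * (a \in A)%:Z - 1).
Proof.
have cntE : cnt a F = (\sum_(A <- F) (a \in A))%N.
  rewrite /cnt -sum1_size big_fset /= big_mkcond.
  by apply: eq_bigr => A _; case: ifP.
by rewrite /surplus cntE -sum1_size !(big_morph Posz PoszD (erefl _)) sumrB -mulr_sumr.
Qed.

Lemma surplus_le (K : choiceType) (a : K) (F : {fset {fset K}}) :
  surplus a F <= (#|` F|)%:Z.
Proof.
have : (cnt a F <= #|` F|)%N.
  by apply: fsubset_leq_card; apply/fsubsetP=> A; rewrite !inE => /andP[].
rewrite /surplus; lia.
Qed.

(** Adding [a] maps the subsets of [U] that avoid [a] bijectively onto those that contain it, so
    exactly half of them contain [a]. *)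
Lemma surplus_fpowerset (K : choiceType) (a : K) (U : {fset K}) :
  a \in U -> surplus a (fpowerset U) = 0.
Proof.
move=> aU; rewrite /surplus.
suff -> : cnt a (fpowerset U) = #|` fpowerset (U `\ a)|.
  by rewrite !card_fpowerset (cardfsD1 a U) aU expnS; lia.
have -> : cnt a (fpowerset U) = #|` [fset a |` A | A in fpowerset (U `\ a)]|.
  rewrite /cnt; congr #|` _|; apply/fsetP=> A; rewrite !inE /= fpowersetE.
  apply/andP/imfsetP => [[AU aA] | [B /=]].
    by exists (A `\ a); rewrite ?fsetD1K //= fpowersetE fsetSD.
  rewrite fpowersetE fsubsetD1 => /andP[BU _] ->.
  by rewrite fset1U1 fsubUset fsub1set aU BU.
apply: card_in_imfset => A B /=; rewrite !fpowersetE !fsubsetD1.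
move=> /andP[_ aA] /andP[_ aB] eqAB.
by rewrite -(fsetU1K aA) eqAB fsetU1K.
Qed.

Definition translate (K : choiceType) (T : {fset K}) (G : {fset {fset K}}) :=
  [fset A `|` T | A in G].

Section Glue.
Variables (K : choiceType) (U : {fset K}) (I : finType).
Variables (T : I -> {fset K}) (G : I -> {fset {fset K}}).
Hypothesis GU : forall i, G i `<=` fpowerset U.
Hypothesis TU : forall i, [disjoint U & T i].
Hypothesis T_inj : injective T.

Definition glue := \bigcup_(i <- [fset i in I]) translate (T i) (G i).

Lemma glueP B :
  reflect (exists i, exists2 A, A \in G i & B = A `|` T i) (B \in glue).
Proof.
apply: (iffP (bigfcupP _ _ _ _)) => [[i _ /imfsetP[A AG ->]] | [i [A AG ->]]].
  by exists i, A.
by exists i; [rewrite !inE | apply/imfsetP; exists A].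
Qed.

Lemma glue_trace i A : A \in G i -> (A `|` T i) `&` U = A.
Proof.
move=> /(fsubsetP (GU i)); rewrite fpowersetE => /fsetIidPl AU.
have := TU i; rewrite -fsetI_eq0 fsetIC => /eqP TU0.
by rewrite fsetIUl AU TU0 fsetU0.
Qed.

Lemma glue_top i A : A \in G i -> (A `|` T i) `\` U = T i.
Proof.
move=> /(fsubsetP (GU i)); rewrite fpowersetE => AU.
have := TU i; rewrite fdisjoint_sym => /fsetDidPl TDU.
by move: AU; rewrite -fsetD_eq0 => /eqP AU; rewrite fsetDUl AU TDU fset0U.
Qed.

(** The part of a member outside [U] is its top, which determines [i], so the blocks are disjoint.
    The part inside [U] recovers [A], so translation is injective, and it decides membership of
    [a]. *)
Lemma surplus_glue a : a \in U -> surplus a glue = \sum_i surplus a (G i).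
Proof.
move=> aU; rewrite surplusE partition_disjoint_bigfcup /=; last first.
  move=> i j _ _ neq_ij; apply/fdisjointP=> B /imfsetP[A /= AG ->].
  apply: contra neq_ij => /imfsetP[A' /= AG' eqA].
  by apply/eqP/T_inj; rewrite -(glue_top AG) eqA glue_top.
rewrite (perm_big (index_enum I)); last first.
  apply: uniq_perm; rewrite ?fset_uniq ?index_enum_uniq // => i.
  by rewrite mem_index_enum !inE.
apply: eq_bigr => i _; rewrite surplusE big_imfset /=; last first.
  by move=> A B AG BG eqAB; rewrite -(glue_trace AG) eqAB glue_trace.
apply: eq_big_seq => A /glue_trace trA.
by rewrite -{2}trA !inE aU andbT.
Qed.

Lemma union_closed_glue :
  (forall i j A B, A \in G i -> B \in G j ->
     exists2 l, T i `|` T j = T l & A `|` B \in G l) ->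
  union_closed glue.
Proof.
move=> GG _ _ /glueP[i [A AG ->]] /glueP[j [B BG ->]].
have [l Tl ABG] := GG _ _ _ _ AG BG.
by apply/glueP; exists l, (A `|` B); rewrite // fsetUACA Tl.
Qed.

End Glue.

Theorem theorem2 (K : choiceType) (K_inf : infinite_universe K)
    (Fc : {fset {fset K}}) (Fc_uc : union_closed Fc)
    (k : nat) (F : 'I_k.+1 -> {fset {fset K}}) (c : 'I_k.+1 -> nat)
    (F_uce : forall i : 'I_k.+1, uce Fc (F i))
    (sum_lt0 : forall a : K, a \in fcover Fc ->
       \sum_(i < k.+1)
         (c i)%:Z * (2 * (cnt a (F i))%:Z - (#|` F i|)%:Z) < 0)
    (c_pos : exists i : 'I_k.+1, (0 < c i)%N) :
  ~ FC_family Fc.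
Proof.
set U := fcover Fc in sum_lt0 *; pose m := #|` Fc|.+1.
pose J := {i : 'I_k.+1 & 'I_(m * c i)}.
have [x [x_inj xU]] := fresh_family K_inf U (option J).
pose X := [fset x j | j : option J].
have xX j : x j \in X by apply/imfsetP; exists j.
(* The fresh element x None keeps every X `\ x (Some j) nonempty, hence apart
   from the top fset0 of Fc. *)
pose T (i : J + bool) := match i with
  | inl j => X `\ x (Some j) | inr b => if b then X else fset0 end.
pose G (i : J + bool) := match i with
  | inl j => F (tag j) | inr b => if b then fpowerset U else Fc end.
have FcU : Fc `<=` fpowerset U.
  apply/fsubsetP=> A AFc; rewrite fpowersetE; apply/fsubsetP=> a aA.
  by apply/bigfcupP; exists A; rewrite ?AFc.
have GU i : G i `<=` fpowerset U.
  by case: i => [j|[]] //=; case: (F_uce (tag j)).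
have TX i : T i `<=` X by case: i => [j|[]] //=; rewrite fsubD1set.
have TU i : [disjoint U & T i].
  rewrite fdisjoint_sym; apply/fdisjointP=> y /(fsubsetP (TX i)).
  by case/imfsetP=> j _ ->.
have x_tag i j : (x (Some j) \in T i) =
    match i with inl j' => j != j' | inr b => b end.
  case: i => [j'|[]] //=; last by rewrite xX.
  by rewrite !inE xX andbT (inj_eq x_inj).
have x_None i : (x None \in T i) = (i != inr false).
  case: i => [j'|[]] //=; last by rewrite xX.
  by rewrite !inE xX andbT (inj_eq x_inj).
(* Only [T (inl j)] and the empty top miss [x (Some j)], and [x None] tells these two apart. *)
have T_inj : injective T.
  move=> [j|b] [j'|b'] eqT.
  - by have := x_tag (inl j) j; rewrite eqT x_tag eqxx => /negbFE/eqP->.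
  - have := x_tag (inl j) j; rewrite eqT x_tag eqxx => b'F.
    by have := x_None (inl j); rewrite eqT b'F x_None.
  - have := x_tag (inl j') j'; rewrite -eqT x_tag eqxx => b'F.
    by have := x_None (inl j'); rewrite -eqT b'F x_None.
  - by have := x_None (inr b); rewrite eqT x_None; case: b b' {eqT} => [] [].
have GT i A : A \in G i -> A `<=` U.
  by move/(fsubsetP (GU i)); rewrite fpowersetE.
have G_uc : union_closed (glue T G).
  apply: union_closed_glue => i j A B AG BG.
  have ABU : A `|` B \in G (inr true).
    by rewrite /= fpowersetE fsubUset (GT i) // (GT j).
  (* The powerset block absorbs every union whose top is [X]. Otherwise the two tops are equal or
     one of them is empty, and the closure properties of [F i] and [Fc] apply. *)
  have [eqX | neqX] := eqVneq (T i `|` T j) X; first by exists (inr true).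
  have XU Y : Y `<=` X -> Y `|` X = X by move/fsetUidPr.
  move: i j AG BG neqX => [i|[]] [j|[]] /= AG BG neqX.
  (* A point of [X] missing from both tops would equal both [x (Some i)] and [x (Some j)]. *)
  - have eq_ij : i = j.
      apply: contraNeq neqX => neq_ij; rewrite eqEfsubset fsubUset !fsubD1set.
      apply/fsubsetP=> y yX; rewrite !inE yX !andbT -negb_and.
      apply: contra neq_ij => /andP[/eqP-> /eqP/x_inj[->]].
      by rewrite eqxx.
    by subst j; exists (inl i); rewrite ?fsetUid //; apply: (F_uce _).2.1.
  - by rewrite XU ?fsubD1set ?eqxx in neqX.
  - by exists (inl i); rewrite ?fsetU0 //; apply: (F_uce _).2.2.
  - by rewrite fsetUC XU ?fsubD1set ?eqxx in neqX.
  - by rewrite fsetUid eqxx in neqX.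
  - by rewrite fsetU0 eqxx in neqX.
  - by exists (inl j); rewrite ?fset0U // fsetUC; apply: (F_uce _).2.2.
  - by rewrite fset0U eqxx in neqX.
  - by exists (inr false); rewrite ?fsetU0 //; apply: Fc_uc.
case/(_ _ G_uc) => [|a aU].
  by apply/fsubsetP=> A AFc; apply/glueP; exists (inr false), A; rewrite ?fsetU0.
apply/negP; rewrite -ltnNge.
suff : surplus a (glue T G) < 0 by rewrite /surplus; lia.
rewrite (surplus_glue GU TU T_inj) // big_sumType /= big_bool /=.
rewrite surplus_fpowerset // add0r.
have -> : \sum_(j : J) surplus a (F (tag j)) =
    m%:Z * \sum_i (c i)%:Z * surplus a (F i).
  (* The summand ignores the copy number, so summing over it multiplies by [m * c i]. *)
  rewrite -(sig_big_dep xpredT (fun _ => xpredT) (fun i _ => surplus a (F i))).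
  rewrite mulr_sumr /=.
  by apply: eq_bigr => i _; rewrite sumr_const card_ord -mulr_natl natz PoszM mulrA.
have := sum_lt0 a aU; have := surplus_le a Fc; rewrite -/(surplus _ _).
(* Integrality enters here: [S < 0] gives [S <= -1], hence [m * S <= -m]. *)
rewrite /m; set S := \sum_i _; nia.
Qed.
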